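(* Let $G$ be a finite generalized dihedral group. If $G$ is a Schur group, then $G$ is dihedral, i.e. $G$ is isomorphic to the dihedral group $D_{2n}$ of order $2n$ for some $n\geq 3$.
   Context: Generalized dihedral group: a nonabelian group that is a semidirect product $A\rtimes\langle b\rangle$ of an abelian group $A$ and a cyclic group $\langle b\rangle$ of order $2$, where $b$ acts on $A$ by inverting every element ($a^b=a^{-1}$ for all $a\in A$). S-rings and Schur groups: let $G$ be a finite group with identity $e$, and for $X\subseteq G$ put $\underline{X}=\sum_{x\in X}x\in\mathbb{Z}G$. A subring $\mathcal{A}\subseteq\mathbb{Z}G$ is an S-ring over $G$ if there is a partition $\mathcal{S}(\mathcal{A})$ of $G$ such that $\{e\}\in\mathcal{S}(\mathcal{A})$; $X\in\mathcal{S}(\mathcal{A})$ implies $X^{-1}=\{x^{-1}:x\in X\}\in\mathcal{S}(\mathcal{A})$; and $\mathcal{A}=\mathrm{Span}_{\mathbb{Z}}\{\underline{X}:X\in\mathcal{S}(\mathcal{A})\}$. Let $G_r\leq\mathrm{Sym}(G)$ be the group of all right translations $x\mapsto xg$, $g\in G$. For every $K$ with $G_r\leq K\leq \mathrm{Sym}(G)$, the orbits on $G$ of the stabilizer $K_e$ form the partition of an S-ring, denoted $V(K,G)$. An S-ring $\mathcal{A}$ over $G$ is schurian if $\mathcal{A}=V(K,G)$ for some $K$ with $G_r\leq K\leq\mathrm{Sym}(G)$. The group $G$ is a Schur group if every S-ring over $G$ is schurian. *)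

(* Defs.v *)
From HB Require Import structures.
From mathcomp Require Import all_boot all_order all_algebra.
From mathcomp Require Import all_fingroup all_solvable.

Set Implicit Arguments.
Unset Strict Implicit.
Unset Printing Implicit Defensive.

Import GRing.Theory GroupScope.
Local Open Scope ring_scope.

(* Elements of ZG are the finite functions gT -> int. The alias keeps the     *)
(* convolution product below apart from the pointwise product of {ffun _}.    *)
Definition group_ring (gT : finGroupType) : Type := {ffun gT -> int}.

HB.instance Definition _ (gT : finGroupType) :=
  GRing.Zmodule.copy (group_ring gT) {ffun gT -> int}.

Section GroupRing.

Variable gT : finGroupType.
Implicit Types (a b c : group_ring gT) (x y : gT).

Definition gr_elt x : group_ring gT := [ffun y => (y == x)%:R].

Definition gr_one : group_ring gT := gr_elt 1%g.

Definition gr_mul a b : group_ring gT :=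
  [ffun x => \sum_(y : gT) a y * b (y^-1 * x)%g].

Fact gr_mulA : associative gr_mul.
Proof.
move=> a b c; apply/ffunP=> x; rewrite !ffunE.
under eq_bigr => y _ do rewrite ffunE mulr_sumr.
under [in RHS]eq_bigr => z _ do rewrite ffunE mulr_suml.
rewrite [RHS]exchange_big /=; apply: eq_bigr => y _.
rewrite [RHS](reindex_inj (mulgI y)) /=; apply: eq_bigr => z _.
by rewrite mulKg invMg mulgA mulrA.
Qed.

Fact gr_mul1 : left_id gr_one gr_mul.
Proof.
move=> a; apply/ffunP=> x; rewrite !ffunE (bigD1 1%g) //= big1 => [|y ney1].
  by rewrite ffunE eqxx mul1r invg1 mul1g addr0.
by rewrite ffunE (negPf ney1) mul0r.
Qed.

Fact gr_mulr1 : right_id gr_one gr_mul.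
Proof.
move=> a; apply/ffunP=> x; rewrite !ffunE (bigD1 x) //= big1 => [|y neyx].
  by rewrite ffunE mulVg eqxx mulr1 addr0.
by rewrite ffunE -eq_mulVg1 (negPf neyx) mulr0.
Qed.

Fact gr_mulDl : left_distributive gr_mul +%R.
Proof.
move=> a b c; apply/ffunP=> x; rewrite !ffunE -big_split /=.
by apply: eq_bigr => y _; rewrite ffunE mulrDl.
Qed.

Fact gr_mulDr : right_distributive gr_mul +%R.
Proof.
move=> a b c; apply/ffunP=> x; rewrite !ffunE -big_split /=.
by apply: eq_bigr => y _; rewrite ffunE mulrDr.
Qed.

Fact gr_one_neq0 : gr_one != 0.
Proof. by apply/eqP=> /ffunP/(_ 1%g); rewrite !ffunE eqxx. Qed.

HB.instance Definition _ := GRing.Zmodule_isNzRing.Build (group_ring gT)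
  gr_mulA gr_mul1 gr_mulr1 gr_mulDl gr_mulDr gr_one_neq0.

Lemma gr_eltM x y : gr_elt x * gr_elt y = gr_elt (x * y)%g.
Proof.
apply/ffunP=> z; rewrite !ffunE (bigD1 x) //= big1 => [|t netx].
  by rewrite !ffunE eqxx mul1r addr0 -(inj_eq (mulgI x)) mulKVg.
by rewrite ffunE (negPf netx) mul0r.
Qed.

Definition simple_quantity (X : {set gT}) : group_ring gT :=
  \sum_(x in X) gr_elt x.

Definition in_Zspan (P : {set {set gT}}) (a : group_ring gT) : Prop :=
  exists c : {set gT} -> int, a = \sum_(X in P) simple_quantity X *~ c X.

(* Boolean predicates lose no S-ring: membership in the span of a partition   *)
(* is decidable, being constancy on each of its classes.                      *)
Definition S_ring (A : {pred group_ring gT}) : Prop :=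
  subring_closed A /\
  exists P : {set {set gT}},
    [/\ partition P [set: gT],
        [set 1%g] \in P,
        forall X : {set gT}, X \in P -> X^-1%g \in P
      & forall a, a \in A <-> in_Zspan P a].

Definition right_translations : {group {perm gT}} :=
  (actperm 'R @* [set: gT])%G.

Lemma mem_right_translations (s : {perm gT}) :
  reflect (exists g : gT, forall x, s x = (x * g)%g)
          (s \in right_translations).
Proof.
apply: (iffP idP) => [/morphimP[g _ _ ->] | [g sg]].
  by exists g => x; rewrite actpermE.
apply/morphimP; exists g; rewrite ?inE //.
by apply/permP=> x; rewrite actpermE sg.
Qed.

Definition stab1_orbits (K : {group {perm gT}}) : {set {set gT}} :=
  [set orbit 'P 'C_K[1%g | 'P] x | x : gT].

Definition schurian (A : {pred group_ring gT}) : Prop :=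
  exists2 K : {group {perm gT}}, right_translations \subset K
    & forall a, a \in A <-> in_Zspan (stab1_orbits K) a.

End GroupRing.

Definition Schur_group (gT : finGroupType) : Prop :=
  forall A : {pred group_ring gT}, S_ring A -> schurian A.

Definition generalized_dihedral (gT : finGroupType) : Prop :=
  ~~ abelian [set: gT] /\
  exists (A : {group gT}) (b : gT),
    [/\ A ><| <[b]> = [set: gT], abelian A, #[b]%g = 2%N
      & forall a, a \in A -> (a ^ b = a^-1)%g].

(* Main.v *)
(* A noncyclic abelian group A contains C_p x C_p for some prime p; since a   *)
(* nonabelian Dih(A) needs A of exponent other than 2, A contains one of      *)
(*   C_p x C_p (p odd),  C_4 x C_2,  C_2 x C_2 x C_m (m odd, m > 1).          *)
(* Over the dihedral extension of each there is a non-schurian S-ring, which   *)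
(* extends to the whole group by adding one class outside the subgroup.       *)
(* For C_p x C_p and C_4 x C_2, write the group as X x L and take the graph D *)
(* of a map h : X -> L that is a relative difference set, with classes 1,     *)
(* L \ 1, the cosets xL (x <> 1) and the two sets of reflections bD and its   *)
(* complement: rigidity of the incidences between points and translates of D  *)
(* forbids the required automorphisms. For C_2 x C_2 x C_m, view the group as *)
(* a covering with fibre L = C_2 x C_2 of the dihedral group of order 2m, and *)
(* cut the fibres over the rotations and over two adjacent reflections into   *)
(* cosets of the three lines of L: following the 2m-cycle formed by the two   *)
(* reflections, an odd m makes the holonomy kill every fibre automorphism.    *)
From HB Require Import structures.
Require Import Defs.
From mathcomp Require Import all_boot all_order all_algebra.
From mathcomp Require Import all_fingroup all_solvable.
From mathcomp Require Import ring.

Set Implicit Arguments.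
Unset Strict Implicit.
Unset Printing Implicit Defensive.

Import GRing.Theory GroupScope.
Local Open Scope ring_scope.

(** An S-ring is handled through a colouring [c] whose colour classes are its basic sets. If it is
    schurian, any two elements [x], [y] of one colour are linked by a permutation that fixes 1,
    sends [x] to [y] and keeps the colour of every quotient [v * u^-1] ([Schur_color_automorphism]).
    A colouring of a subgroup extends to the whole group by one new colour outside
    ([color_ext_mul]), so a Schur group contains no subgroup carrying a colouring with two
    like-coloured elements that no such permutation links.

    Such colourings exist over three kinds of generalized dihedral groups. Two come from relative
    difference sets, where [bent_colorM] gives the S-ring and [bent_automorphism] the rigidity; the
    third comes from the Klein covering ([klein_colorM], [Schur_no_klein_cover]).

    As G is nonabelian, some [a] in A has [a ^+ 2 != 1]. If A were not cyclic it would contain some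
    C_p x C_p, and together with [a] this would yield one of the three forbidden subgroups
    ([Schur_cyclic]). So A is cyclic, and the presentation of the dihedral group identifies G. *)

(** * Spans of partitions as functions constant on the classes *)

Section Spans.

Variable gT : finGroupType.
Implicit Types (a b : group_ring gT) (P : {set {set gT}}) (X : {set gT}).

Lemma simple_quantityE X x : simple_quantity X x = (x \in X)%:R.
Proof.
rewrite /simple_quantity sum_ffunE; case: (boolP (x \in X)) => xX.
  rewrite (bigD1 x) //= ffunE eqxx big1 ?addr0 // => y /andP[_ nyx].
  by rewrite ffunE eq_sym (negPf nyx).
rewrite big1 // => y yX; rewrite ffunE; case: eqP => // xy.
by rewrite xy yX in xX.
Qed.

Lemma gr_mulrzE a (n : int) x : (a *~ n) x = a x * n.
Proof.
have natE k : (a *+ k) x = a x *+ k.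
  by elim: k => [|k IHk]; rewrite ?mulr0n ?mulrS !ffunE // IHk.
by rewrite -mulrzz; case: n => n;
  rewrite ?NegzE ?mulrNz ?[LHS]ffunE -!pmulrn natE.
Qed.

Lemma ZspanP P a : partition P [set: gT] ->
  in_Zspan P a <-> (forall X, X \in P -> {in X &, forall x y, a x = a y}).
Proof.
move=> partP; have [/eqP covP trivP nP] := and3P partP.
have inP x : x \in pblock P x by rewrite mem_pblock covP inE.
have spanE (c : {set gT} -> int) x :
    (\sum_(X in P) simple_quantity X *~ c X : group_ring gT) x
      = c (pblock P x).
  have xP : pblock P x \in P by rewrite pblock_mem // covP inE.
  rewrite sum_ffunE (bigD1 (pblock P x)) //= big1 ?addr0 => [|X /andP[XP nX]].
    by rewrite gr_mulrzE simple_quantityE inP mul1r.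
  rewrite gr_mulrzE simple_quantityE; case: (boolP (x \in X)) => [xX|];
    last by rewrite mul0r.
  by rewrite (def_pblock trivP XP xX) eqxx in nX.
split=> [[c ->] X XP x y xX yX|aP].
  by rewrite !spanE (def_pblock trivP XP xX) (def_pblock trivP XP yX).
(* The coefficient of a class is the value of [a] at any of its points; the default 0 concerns only
   the empty set, which is not a class. *)
exists (fun X => if [pick x in X] is Some x then a x else 0).
apply/ffunP=> x; rewrite spanE; case: pickP => [y yX|/(_ x)];
  last by rewrite inP.
by apply: (aP (pblock P x)); rewrite // pblock_mem // covP inE.
Qed.

Lemma stab1_orbits_partition (K : {group {perm gT}}) :
  partition (stab1_orbits K) [set: gT].
Proof.
have := @orbit_partition _ _ _ 'P%act 'C_K[1%g | 'P]%G [set: gT].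
rewrite /stab1_orbits.
set P := [set _ | x in _]; set Q := [set _ | x in _].
have -> : P = Q by apply/setP=> X; apply/imsetP/imsetP=> -[x _ ->]; exists x.
by apply; apply/actsP=> /= s _ x; rewrite !inE.
Qed.

End Spans.

(** * S-rings given by colourings, and the permutations that schurity provides *)

Section Coloring.

Variables (gT : finGroupType) (T : eqType) (c : gT -> T).

Definition color_constant (a : group_ring gT) : Prop :=
  forall x y, c x = c y -> a x = a y.

Hypothesis c1 : forall x, c x = c 1%g -> x = 1%g.
Hypothesis cV : forall x y, c x = c y -> c x^-1%g = c y^-1%g.
Hypothesis cM : forall a b : group_ring gT,
  color_constant a -> color_constant b -> color_constant (a * b).

Definition color_ring : {pred group_ring gT} :=
  fun a => [forall x, forall y, (c x == c y) ==> (a x == a y)].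

Lemma color_ringP a : reflect (color_constant a) (a \in color_ring).
Proof.
apply: (iffP forallP) => [ca x y /eqP cxy|ca x].
  by have /forallP/(_ y) := ca x; rewrite cxy => /eqP.
by apply/forallP=> y; apply/implyP=> /eqP cxy; apply/eqP/ca.
Qed.

Lemma color_S_ring : S_ring color_ring.
Proof.
split.
  split=> [|a b /color_ringP ca /color_ringP cb|a b /color_ringP ca
    /color_ringP cb].
  - apply/color_ringP=> x y cxy; rewrite !ffunE.
    case: (eqVneq y 1%g) => [y1|ny1].
      by rewrite (c1 (etrans cxy (congr1 c y1))) eqxx.
    by case: eqP => // x1;
      rewrite (c1 (esym (etrans (esym (congr1 c x1)) cxy))) eqxx in ny1.
  - by apply/color_ringP=> x y cxy; rewrite !ffunE (ca _ _ cxy) (cb _ _ cxy).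
  - exact/color_ringP/cM.
pose blk x := [set y | c x == c y].
have blkE X : reflect (exists x, X = blk x) (X \in preim_partition c [set: gT]).
  apply: (iffP imsetP) => [[x _ ->]|[x ->]]; exists x => //;
    by apply/setP=> y; rewrite !inE.
exists (preim_partition c [set: gT]); split.
- exact: preim_partitionP.
- apply/blkE; exists 1%g; apply/setP=> x; rewrite !inE.
  by apply/eqP/eqP=> [->|/esym/c1].
- move=> X /blkE[x ->]; apply/blkE; exists x^-1%g; apply/setP=> y; rewrite !inE.
  by apply/eqP/eqP=> /cV; rewrite invgK.
- move=> a; apply: iff_trans (iff_sym (ZspanP _ (preim_partitionP _ _))).
  split=> [/color_ringP ca X /blkE[x ->] y z|ca].
    by rewrite !inE => /eqP cy /eqP cz; apply: ca; rewrite -cy.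
  apply/color_ringP=> x y cxy; apply: (ca (blk x)); first by apply/blkE;
    exists x.
    by rewrite inE.
  by rewrite inE cxy.
Qed.

(** Schurity makes the colour classes coincide with the orbits of the stabilizer of 1 in K. Since K
    contains the right translations, preserving colours of elements upgrades to preserving colours
    of quotients. *)
Lemma Schur_color_automorphism x y : Schur_group gT -> c x = c y ->
  exists f : {perm gT}, [/\ f 1%g = 1%g, f x = y
    & forall u v, c (f v * (f u)^-1)%g = c (v * u^-1)%g].
Proof.
move=> /(_ _ color_S_ring)[K rK AK] cxy.
have ccK a : (color_constant a) <->
    (forall X, X \in stab1_orbits K -> {in X &, forall x y, a x = a y}).
  apply: iff_trans (ZspanP _ (stab1_orbits_partition K)).
  by apply: iff_trans (AK a); split=> /color_ringP.
have orbK z : orbit 'P 'C_K[1%g | 'P] z \in stab1_orbits K.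
  by apply/imsetP; exists z.
have cK s z : s \in K -> s 1%g = 1%g -> c (s z) = c z.
  (* The indicator of a colour class lies in the S-ring, hence is constant on orbits. *)
  move=> sK s1; have [+ _] := ccK (simple_quantity [set y | c z == c y]).
  move=> /(_ _ _ (orbK z) (s z) z); rewrite !simple_quantityE !inE eqxx.
  case: eqP => [-> //|_] H; suff: (0 : int) = 1 by [].
  apply: H; last exact: orbit_refl.
    by move=> u v cuv; rewrite !simple_quantityE !inE cuv.
  by apply/orbitP; exists s => //; apply/setIP; split=> //; apply/astab1P.
(* Conversely, the indicator of an orbit lies in the S-ring, hence is constant on colours. *)
have [_ H] := ccK (simple_quantity (orbit 'P 'C_K[1%g | 'P] x)).
have : y \in orbit 'P 'C_K[1%g | 'P] x.
  suff: (y \in orbit 'P 'C_K[1%g | 'P] x)%:R = 1 :> int by case: (y \in _).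
  have -> : 1 = (x \in orbit 'P 'C_K[1%g | 'P] x)%:R :> int
    by rewrite orbit_refl.
  rewrite -!simple_quantityE;
    apply: H (esym cxy) => X /imsetP[z _ ->] u v uz vz.
  rewrite !simple_quantityE; congr (_%:R)%R; congr nat_of_bool.
  by rewrite [u \in _]orbit_sym [v \in _]orbit_sym (orbit_eqP uz) (orbit_eqP
    vz).
case/orbitP=> s /setIP[sK /astab1P s1] sx.
exists s; split=> // u v.
pose r g := actperm 'R%act g : {perm gT}.
have rE g z : r g z = (z * g)%g by rewrite actpermE.
have rK' g : r g \in K by apply: (subsetP rK); apply: mem_morphim; rewrite inE.
(* This product acts from left to right as [z] to [s (z * u) * (s u)^-1]; it fixes 1, so it
   preserves colours. *)
have := cK (r u * s * r (s u)^-1)%g (v * u^-1)%g.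
rewrite !groupM ?rK' // !permM !rE mul1g mulgV mulgKV => -> //.
Qed.

End Coloring.

(** * Extending a colouring from a subgroup to the whole group *)

Section Extension.

Variables (hT gT : finGroupType) (phi : hT -> gT) (T : eqType) (c : hT -> T).

Hypothesis phi_inj : injective phi.
Hypothesis phiM : {morph phi : x y / (x * y)%g}.
Hypothesis c1 : forall x, c x = c 1%g -> x = 1%g.
Hypothesis cV : forall x y, c x = c y -> c x^-1%g = c y^-1%g.
Hypothesis cM : forall a b : group_ring hT,
  color_constant c a -> color_constant c b -> color_constant c (a * b).

Let phi1 : phi 1%g = 1%g.
Proof. by apply: (mulgI (phi 1%g)); rewrite -phiM !mulg1. Qed.

Let phiV : {morph phi : x / x^-1%g}.
Proof. by move=> x; apply: (mulgI (phi x)); rewrite -phiM !mulgV phi1. Qed.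

Definition color_ext (g : gT) : option T :=
  if [pick h | phi h == g] is Some h then Some (c h) else None.

Let cphi h : color_ext (phi h) = Some (c h).
Proof.
rewrite /color_ext; case: pickP => [k /eqP/phi_inj-> //|/(_ h)].
by rewrite eqxx.
Qed.

Let c_out g : (forall h, phi h != g) -> color_ext g = None.
Proof. by move=> ng; rewrite /color_ext; case: pickP => // k;
  rewrite (negPf (ng k)). Qed.

Let phi_cases g : (exists h, g = phi h) \/ (forall h, phi h != g).
Proof.
case: (pickP (fun h => phi h == g)) => [h /eqP<-|ng]; first by left; exists h.
by right=> h; rewrite ng.
Qed.

(* On a color-constant function, subtracting the common value taken outside   *)
(* the subgroup leaves a function supported on the subgroup.                  *)
Lemma color_ext_mul (a b : group_ring gT) :
  color_constant color_ext a -> color_constant color_ext b ->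
  color_constant color_ext (a * b).
Proof.
have split_out (d : group_ring gT) : color_constant color_ext d ->
    exists r : int, forall g, (forall h, phi h != g) -> d g = r.
  move=> cd; case: (pickP (fun g => [forall h, phi h != g])) =>
    [g0 /forallP ng0|no].
    by exists (d g0) => g ng; apply: cd; rewrite !c_out.
  by exists 0 => g ng; have := no g; rewrite (introT forallP ng).
move=> ca cb; have [r ra] := split_out a ca; have [s sb] := split_out b cb.
pose a0 : group_ring hT := [ffun h => a (phi h) - r].
pose b0 : group_ring hT := [ffun h => b (phi h) - s].
have cc0 : color_constant c (a0 * b0).
  by apply: cM => x y cxy; rewrite !ffunE; congr (_ - _); [apply: ca|apply: cb];
     rewrite !cphi cxy.
pose k := \sum_g (a g - r) * s + \sum_g r * (b g - s) + \sum_(g : gT) r * s.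
(* A convolution with a constant function is constant, so the product of [a] and [b] differs from
   that of [a - r] and [b - s] by the constant [k]. *)
have abE g : (a * b) g = \sum_u (a u - r) * (b (u^-1 * g)%g - s) + k.
  rewrite ffunE /k [X in _ + (_ + X
    + _)](reindex_inj (inj_comp (mulIg g) invg_inj)) /=.
  rewrite -!big_split /=; apply: eq_bigr => u _.
  by ring.
have abphi g : \sum_u (a u - r) * (b (u^-1 * g)%g - s)
    = \sum_h (a (phi h) - r) * (b ((phi h)^-1 * g)%g - s).
  rewrite (bigID (fun u =>
    u \in phi @: [set: hT])) /= [X in _ + X]big1 ?addr0; last first.
    move=> u nu; rewrite ra ?subrr ?mul0r // => h.
    by apply: contraNneq nu => <-; apply: imset_f.
  by rewrite big_imset /= => [|h h' _ _ /phi_inj //]; apply: eq_bigl => h;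
    rewrite inE.
have abin h : (a * b) (phi h) = (a0 * b0) h + k.
  by rewrite abE abphi ffunE; congr (_ + _); apply: eq_bigr => u _;
    rewrite !ffunE -phiV phiM.
have about g : (forall h, phi h != g) -> (a * b) g = k.
  move=> ng; rewrite abE abphi big1 ?add0r // => h _.
  rewrite sb ?subrr ?mulr0 // => h';
    rewrite -(inj_eq (mulgI (phi h))) -phiM mulKVg.
  exact: ng.
move=> x y; case: (phi_cases x) => [[h ->]|nx];
  case: (phi_cases y) => [[h' ->]|ny].
- by rewrite !cphi !abin => -[/cc0->].
- by rewrite cphi c_out.
- by rewrite cphi c_out.
- by rewrite !about.
Qed.

Lemma Schur_subgroup_color_automorphism x y : Schur_group gT -> c x = c y ->
  exists f : {perm hT}, [/\ f 1%g = 1%g, f x = y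
    & forall u v, c (f v * (f u)^-1)%g = c (v * u^-1)%g].
Proof.
move=> SG cxy.
have e1 g : color_ext g = color_ext 1%g -> g = 1%g.
  case: (phi_cases g) => [[h ->]|ng]; rewrite -phi1 ?cphi;
    last by rewrite c_out.
  by case=> /c1->.
have eV g g' : color_ext g = color_ext g' -> color_ext g^-1%g
  = color_ext g'^-1%g.
  have outV z : (forall h, phi h != z) -> forall h, phi h != z^-1%g.
    by move=> nz h; rewrite -(inj_eq invg_inj) invgK -phiV.
  case: (phi_cases g) => [[h ->]|ng]; case: (phi_cases g') => [[h' ->]|ng'].
  - by rewrite -!phiV !cphi => -[/cV->].
  - by rewrite cphi c_out.
  - by rewrite cphi c_out.
  - by rewrite !c_out //; apply: outV.
have [|f [f1 fx fc]] := @Schur_color_automorphism _ _ _ e1 eV color_ext_mul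
  (phi x) (phi y) SG; first by rewrite !cphi cxy.
(* [f] keeps the colour relative to 1, hence never leaves the image of [phi], whose complement has
   the colour [None]. *)
have fphi h : {k | f (phi h) == phi k}.
  apply: sigW; case: (phi_cases (f (phi h))) => [[k ->]|nk]; first by exists k.
  by have := fc 1%g (phi h); rewrite f1 !invg1 !mulg1 cphi c_out.
pose f0 h := sval (fphi h).
have f0E h : phi (f0 h) = f (phi h) by rewrite /f0; case: (fphi h) => k /= /eqP.
have f0_inj : injective f0.
  by move=> h k /(congr1 phi); rewrite !f0E => /perm_inj/phi_inj.
exists (perm f0_inj); split=> [||u v]; rewrite ?permE.
- by apply: phi_inj; rewrite f0E phi1 f1.
- by apply: phi_inj; rewrite f0E fx.
- apply: Some_inj; rewrite -!cphi !phiM !phiV !f0E; exact: fc.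
Qed.

End Extension.
(* The triple (x, y, k) stands for xyb^k in Dih(X x L). *)
Definition dih (X L : finZmodType) : Type := (X * L * bool)%type.

HB.instance Definition _ (X L : finZmodType) := Finite.on (dih X L).

(** * The generalized dihedral group of X x L and its embeddings *)

Section Dih.

Variables X L : finZmodType.
Implicit Types g h : dih X L.

Definition sgb (V : zmodType) (k : bool) (x : V) := if k then - x else x.

Definition dih_mul g h : dih X L :=
  (g.1.1 + sgb g.2 h.1.1, g.1.2 + sgb g.2 h.1.2, g.2 (+) h.2).
Definition dih_one : dih X L := (0, 0, false).
Definition dih_inv g : dih X L := (sgb (~~ g.2) g.1.1, sgb (~~ g.2) g.1.2, g.2).

Fact dih_mulA : associative dih_mul.
Proof.
by move=> [[x y] []] [[x' y'] []] [[x'' y''] []];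
  rewrite /dih_mul /= ?opprD ?opprK !addrA.
Qed.

Fact dih_mul1 : left_id dih_one dih_mul.
Proof. by move=> [[x y] k]; rewrite /dih_mul /= !add0r. Qed.

Fact dih_mulV : left_inverse dih_one dih_inv dih_mul.
Proof. by move=> [[x y] []]; rewrite /dih_mul /= ?addNr ?subrr. Qed.

HB.instance Definition _ := Finite_isGroup.Build (dih X L)
  dih_mulA dih_mul1 dih_mulV.

Lemma dih_mulE g h :
  (g * h)%g = (g.1.1 + sgb g.2 h.1.1, g.1.2 + sgb g.2 h.1.2, g.2 (+) h.2).
Proof. by []. Qed.

Lemma dih_invE g : (g^-1)%g = (sgb (~~ g.2) g.1.1, sgb (~~ g.2) g.1.2, g.2).
Proof. by []. Qed.

Lemma dih_1E : (1%g : dih X L) = (0, 0, false). Proof. by []. Qed.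

Lemma dih_sum (F : dih X L -> int) :
  \sum_g F g = \sum_x \sum_y F (x, y, false) + \sum_x \sum_y F (x, y, true).
Proof.
transitivity (\sum_(p : X * L * bool) F (p.1, p.2)); first by apply: eq_bigr;
  case.
rewrite -(pair_bigA _ (fun p k => F (p, k))) exchange_big big_bool /= addrC.
by congr (_ + _); rewrite pair_bigA; apply: eq_bigr => -[].
Qed.

End Dih.

Lemma dih_embedding (gT : finGroupType) (X L : finZmodType) (i : X ->
  gT) (j : L -> gT)
    (A : {group gT}) (b : gT) :
  {morph i : x y / x + y >-> (x * y)%g} -> {morph j : x y / x
    + y >-> (x * y)%g} ->
  injective i -> injective j -> (forall x, i x \in A) -> (forall y,
    j y \in A) ->
  (forall x y, i x = j y -> x = 0) ->
  abelian A -> b \notin A -> (b * b = 1)%g -> (forall a,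
    a \in A -> a ^ b = a^-1)%g ->
  let phi (g : dih X L) := (i g.1.1 * j g.1.2 * b ^+ g.2)%g in
  injective phi /\ {morph phi : g h / (g * h)%g}.
Proof.
move=> iD jD i_inj j_inj iA jA ij cA nbA bb Ab phi.
have iN x : i (- x) = (i x)^-1%g.
  by apply: (mulgI (i x)); rewrite -iD subrr mulgV; apply: (mulgI (i 0));
    rewrite -iD addr0 mulg1.
have jN x : j (- x) = (j x)^-1%g.
  by apply: (mulgI (j x)); rewrite -jD subrr mulgV; apply: (mulgI (j 0));
    rewrite -jD addr0 mulg1.
have comm x y : x \in A -> y \in A -> (x * y = y * x)%g.
  by move=> xA yA; apply: (centsP cA).
have bA a : a \in A -> (b * a = a^-1 * b)%g.
  by move=> aA; rewrite -(Ab _ aA) conjgE !mulgA -[in RHS](mulgA _ b b) bb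
    mulg1;
     rewrite -[b^-1%g]mulg1 -{1}bb mulKg.
split=> [[[x y] k] [[x' y'] k']|[[x y] k] [[x' y'] k']]; rewrite /phi /=.
  (* If the exponents of [b] differed, [b] would lie in A. *)
  move=> E; have kk : k = k'.
    apply/eqP; apply: contraNT nbA; case: k k' E => -[] //= /esym;
      rewrite ?mulg1 ?expg1.
      by move=> E _; rewrite -(groupMl b (groupM (iA x) (jA y))) -E groupM.
    by move=> E _; rewrite -(groupMl b (groupM (iA x') (jA y'))) E groupM.
  move: E; rewrite kk => /mulIg E.
  have E2 : i (x - x') = j (y' - y).
    rewrite iD jD iN jN; apply: (mulIg (i x')); rewrite mulgKV.
    apply: (mulIg (j y));
      rewrite E -(mulgA (j y')) (comm (j y)^-1%g) ?groupV // mulgA.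
    by rewrite mulgKV comm.
  have x0 := ij _ _ E2; have xx : x = x' by apply/eqP; rewrite -subr_eq0 x0.
  by move: E; rewrite xx => /mulgI/j_inj->.
have ijA x0 y0 : (i x0 * j y0)%g \in A by rewrite groupM.
have -> : (i (x + sgb k x') * j (y + sgb k y') * b ^+ (k (+) k')
    = i x * j y * (i (sgb k x') * j (sgb k y')) * b ^+ (k (+) k'))%g.
  rewrite iD jD -!mulgA; congr (_ * _)%g; rewrite !mulgA; congr (_ * _ * _)%g.
  exact: comm.
rewrite -!(mulgA (i x * j y)%g); congr (_ * _)%g.
case: k => /=; rewrite ?mul1g // ?expg1 iN jN.
rewrite mulgA bA // invMg (comm (j y')^-1%g) ?groupV //.
rewrite -!mulgA; do 2!congr (_ * _)%g.
by case: k'; rewrite /= ?mulg1 // ?expg1 ?bb.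
Qed.

(** * The S-ring of a relative difference set and its rigidity *)

Lemma sum_delta (I : finType) (F : I -> int) (i : I) :
  \sum_j F j * (j == i)%:R = F i.
Proof.
rewrite (bigD1 i) //= eqxx mulr1 big1 ?addr0 // => j /negPf->.
by rewrite mulr0.
Qed.

Lemma sum_delta2 (I J : finType) (F : I -> J -> int) (i : I) (j : J) :
  \sum_k \sum_l F k l * ((k == i) && (l == j))%:R = F i j.
Proof.
rewrite -[RHS](sum_delta (F i)) -[RHS](sum_delta (fun k =>
  \sum_l F k l * (l == j)%:R)).
apply: eq_bigr => k _; rewrite mulr_suml; apply: eq_bigr => l _.
by case: eqP => _; case: eqP => _; rewrite ?mulr0 ?mulr1.
Qed.

Section Bent.

Variables (X L : finZmodType) (h : X -> L).

(* For [lambda = #|X| / #|L|] this says that the graph of [h] is a semiregular *)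
(* relative difference set in X x L relative to L.                            *)
Definition bent (lambda : int) : Prop := forall x y, x != 0 ->
  \sum_u (h u == y + h (u - x))%:R = lambda.

(** The classes are the identity, the rest of L, the other cosets of L, the reflections on the graph
    of [h], and those off it. The leading 0 on reflections is a filler. *)
Definition bent_color (g : dih X L) : X * bool * bool :=
  if g.2 then (0, g.1.2 == h g.1.1, true)
  else (g.1.1, (g.1.1 == 0) && (g.1.2 == 0), false).

Variables (lambda : int) (l0 : L).
Hypotheses (bent_h : bent lambda) (l0_neq0 : l0 != 0).

Lemma bent_color1 g : bent_color g = bent_color 1%g -> g = 1%g.
Proof.
by case: g => [[x y] []]; rewrite /bent_color /= ?eqxx // => -[-> /=];
  rewrite eqxx => /eqP->.
Qed.

Lemma bent_colorV g g' : bent_color g = bent_color g' -> bent_color g^-1%g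
  = bent_color g'^-1%g.
Proof.
case: g g' => [[x y] []] [[x' y'] []];
  rewrite /bent_color !dih_invE //= => -[->].
by rewrite !oppr_eq0 => ->.
Qed.

(** This normal form reduces closure under convolution to computing coefficients. The point [l0]
    supplies a rotation of each coset other than 1 and a reflection off the graph, where [al] and
    [be] are read off. *)
Lemma bent_color_constantP (a : group_ring (dih X L)) :
  color_constant bent_color a <->
  exists (al : X -> int) (ep be de : int), forall x y,
    a (x, y, false) = al x + ep * ((x == 0) && (y == 0))%:R
    /\ a (x, y, true) = be + de * (y == h x)%:R.
Proof.
split=> [ca|[al [ep [be [de aE]]]] [[x y] k] [[x' y'] k']]; last first.
  case: k k' => -[]; rewrite /bent_color //= => -[].
    by rewrite !(aE _ _).2 => ->.
  by rewrite !(aE _ _).1 => -> ->.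
exists (fun x => a (x, l0, false)), (a (0, 0, false) - a (0, l0, false)),
  (a (0, h 0 + l0, true)), (a (0, h 0, true) - a (0, h 0 + l0, true)) => x y.
have hl0 : (h 0 + l0 == h 0)
  = false by rewrite -subr_eq0 addrC addKr (negPf l0_neq0).
split.
  case: (boolP (_ && _)) => [/andP[/eqP-> /eqP->]|nxy];
    first by rewrite mulr1 addrC subrK.
  rewrite mulr0 addr0; apply: ca; rewrite /bent_color /= (negPf nxy).
  by rewrite (negPf l0_neq0) andbF.
case: eqP => [->|/eqP nyx]; first by rewrite mulr1 addrC subrK; apply: ca;
  rewrite /bent_color /= !eqxx.
by rewrite mulr0 addr0; apply: ca; rewrite /bent_color /= hl0 (negPf nyx).
Qed.

Lemma bent_colorM (a b : group_ring (dih X L)) :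
  color_constant bent_color a -> color_constant bent_color b ->
  color_constant bent_color (a * b).
Proof.
move=> /bent_color_constantP[al [ep [be [de aE]]]].
move=> /bent_color_constantP[al' [ep' [be' [de' bE]]]].
apply/bent_color_constantP.
pose nX : int := #|X|%:R; pose nL : int := #|L|%:R.
exists (fun x => \sum_(p : X) nL * (al p * al' (x - p)) + ep * al' x
  + ep' * al x
    + nX * (nL * (be * be') + be * de' + de * be')
      + de * de' * lambda * (x != 0)%:R),
  (ep * ep' + de * de' * nX),
  (be' * (\sum_(p : X) nL * al p + ep) + be * (\sum_(p : X) nL * al' p + ep')
    + de' * \sum_(p : X) al p + de * \sum_(p : X) al' p),
  (ep * de' + ep' * de).
have sumL (r : int) : \sum_(q : L) r = nL * r by rewrite sumr_const -mulr_natl.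
have sumX (r : int) : \sum_(q : X) r = nX * r by rewrite sumr_const -mulr_natl.
have aF x y := (aE x y).1; have aT x y := (aE x y).2.
have bF x y := (bE x y).1; have bT x y := (bE x y).2.
have subE (V : zmodType) (u v : V) : (- u + v == 0) = (u == v).
  by rewrite addrC subr_eq0 eq_sym.
move=> x y; rewrite !ffunE !dih_sum; split.
  have -> : \sum_(p : X) \sum_(q : L) a (p, q, false) * b (((p, q,
    false) : dih X L)^-1 * (x, y, false))%g
     = \sum_(p : X) nL * (al p * al' (x - p)) + ep * al' x + ep' * al x
       + ep * ep' * ((x == 0) && (y == 0))%:R.
    transitivity (\sum_(p : X) \sum_(q : L) al p * al' (x - p)
        + \sum_(p : X) \sum_(q : L) ep * al' (x - p) * ((p == 0) && (q == 0))%:R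
        + \sum_(p : X) \sum_(q : L) ep' * al p * ((p == x) && (q == y))%:R
        + \sum_(p : X) \sum_(q : L) ep * ep' * ((p == 0) && (q == 0))%:R * ((p
          == x) && (q == y))%:R).
      rewrite -!big_split; apply: eq_bigr => p _; rewrite -!big_split;
        apply: eq_bigr => q _.
      by rewrite dih_invE dih_mulE /= aF bF !subE [- p + x]addrC; ring.
    rewrite !sum_delta2 subr0; congr (_ + _ + _ + _).
    by apply: eq_bigr => p _; rewrite sumL.
  have -> : \sum_(p : X) \sum_(q : L) a (p, q, true) * b (((p, q,
    true) : dih X L)^-1 * (x, y, false))%g
     = nX * (nL * (be * be') + be * de' + de * be')
       + de * de' * \sum_(p : X) (h p == y + h (p - x))%:R.
    transitivity (\sum_(p : X) (\sum_(q : L) be * be'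
      + \sum_(q : L) be * de' * (q == y + h (p - x))%:R
        + \sum_(q : L) de * be' * (q == h p)%:R
        + \sum_(q : L) de * de' * (q == y + h (p - x))%:R * (q == h p)%:R)).
      apply: eq_bigr => p _; rewrite -!big_split; apply: eq_bigr => q _.
      by rewrite dih_invE dih_mulE /= aT bT subr_eq [h _ + y]addrC; ring.
    under eq_bigr => p _ do rewrite !sum_delta sumL.
    by rewrite big_split sumX mulr_sumr.
  (* The only term not visibly in normal form counts incidences of the graph with its translate:
     bentness makes it [lambda] for nonzero [x], and at [x = 0] it is concentrated at the
     identity. *)
  case: (eqVneq x 0) => [->|x0] /=; last by rewrite bent_h //; ring.
  have -> : \sum_(p : X) (h p == y + h (p - 0))%:R = nX * (y == 0)%:R.
    rewrite -sumX; apply: eq_bigr => p _.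
    by rewrite subr0 -subr_eq0 opprD addrCA subrr addr0 oppr_eq0.
  by ring.
have -> : \sum_(p : X) \sum_(q : L) a (p, q, false) * b (((p, q,
  false) : dih X L)^-1 * (x, y, true))%g
     = be' * (\sum_(p : X) nL * al p + ep) + de' * (\sum_(p : X) al p)
       + ep * de' * (y == h x)%:R.
  transitivity (\sum_(p : X) (\sum_(q : L) be' * al p
    + \sum_(q : L) de' * al p * (q == y - h (x - p))%:R)
     + \sum_(p : X) \sum_(q : L) ep * (be'
       + de' * (y - q == h (x - p))%:R) * ((p == 0) && (q == 0))%:R).
    rewrite -!big_split; apply: eq_bigr => p _; rewrite -!big_split;
      apply: eq_bigr => q _.
    rewrite dih_invE dih_mulE /= aF bT [- p + x]addrC [- q + y]addrC.
    have -> : (q == y - h (x - p)) = (y - q == h (x - p)).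
      by rewrite eq_sym !subr_eq addrC.
    by ring.
  rewrite sum_delta2 !subr0.
  under eq_bigr => p _ do rewrite sum_delta sumL.
  by rewrite big_split /= -!mulr_sumr; ring.
have -> : \sum_(p : X) \sum_(q : L) a (p, q, true) * b (((p, q,
  true) : dih X L)^-1 * (x, y, true))%g
     = be * (\sum_(p : X) nL * al' p + ep') + de * (\sum_(p : X) al' p)
       + ep' * de * (y == h x)%:R.
  transitivity (\sum_(p : X) (\sum_(q : L) be * al' (p - x)
    + \sum_(q : L) de * al' (p - x) * (q == h p)%:R)
     + \sum_(p : X) \sum_(q : L) ep' * (be
       + de * (q == h p)%:R) * ((p == x) && (q == y))%:R).
    rewrite -!big_split; apply: eq_bigr => p _; rewrite -!big_split;
      apply: eq_bigr => q _.
    by rewrite dih_invE dih_mulE /= aT bF !subr_eq0; ring.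
  rewrite sum_delta2.
  under eq_bigr => p _ do rewrite sum_delta sumL.
  rewrite big_split /= -!mulr_sumr.
  have <- : \sum_(p : X) al' (p - x) = \sum_p al' p.
    by rewrite [RHS](reindex_inj (addIr (- x))).
  by ring.
by ring.
Qed.

End Bent.
(** Quotients of reflections show that [f] shifts their X-coordinate by a single [k], and quotients
    of a reflection by a rotation show that it preserves incidence with the graph. Eliminating the
    action [G] on reflections leaves an equation for [F] whose right side must be the same for every
    [w]. *)
Lemma bent_automorphism (X L : finZmodType) (h : X -> L) (f : dih X L ->
  dih X L) :
  f 1%g = 1%g ->
  (forall u v, bent_color h (f v * (f u)^-1)%g = bent_color h (v * u^-1)%g) ->
  exists (F : X -> L -> L) (k : X),
    (forall x y, f (x, y, false) = (x, F x y, false)) /\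
    forall x w y, F x y = h (w + x + k) - h (w + k) + F 0 (h w - h (w + x) + y).
Proof.
move=> f1 fc; pose F x y := (f (x, y, false)).1.2;
  pose k := (f (0, 0, true)).1.1.
pose G w z := (f (w, z, true)).1.2.
have fc1 v : bent_color h (f v) = bent_color h v.
  by have := fc 1%g v; rewrite f1 invg1 !mulg1.
have fF x y : f (x, y, false) = (x, F x y, false).
  by have := fc1 (x, y, false); rewrite /F; case: (f _) => [[x' y'] []] // [->].
have fG w z : f (w, z, true) = (w + k, G w z, true).
  have := fc (0, 0, true) (w, z, true); rewrite /G /k.
  have := fc1 (0, 0, true); have := fc1 (w, z, true).
  case: (f (w, z, true)) => [[x' y'] []] //;
    case: (f (0, 0, true)) => [[x0 y0] []] // _ _.
  by rewrite /bent_color /= => -[+ _]; rewrite oppr0 addr0 => <-;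
    rewrite addrNK.
have GF x y w z : (G w z + F x y == h (w + k + x)) = (z + y == h (w + x)).
  have := fc (x, y, false) (w, z, true);
    rewrite fF fG /bent_color !dih_mulE !dih_invE /=.
  by rewrite !opprK => -[].
exists F, k; split=> // x w y.
have GE x' y' : G w (h (w + x') - y') = h (w + x' + k) - F x' y'.
  by apply/eqP; rewrite eq_sym subr_eq eq_sym -(addrA w x') (addrC x') addrA
    GF subrK.
have E : h (w + x + k) - F x y = h (w + k) - F 0 (h w - h (w + x) + y).
  (* The points [(x, y)] and [(0, h w - h (w + x) + y)] are incident with the same reflection over
     [w]. *)
  rewrite -GE -[in RHS](addr0 w) -GE addr0; congr (G w _).
  by rewrite opprD opprB addrA (addrC (h w)) subrK.
by rewrite -addrA (addrC (- h (w + k))) -opprB -E opprB addrC subrK.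
Qed.


(** * Two bent maps and the subgroups they exclude *)

(** The squares cancel in [u ^+ 2 = y + (u - x) ^+ 2], leaving a linear equation in [u] with exactly
    one root. *)
Lemma square_bent (F : finFieldType) : 2%:R != 0 :> F -> bent (fun x : F =>
  x ^+ 2) 1.
Proof.
move=> F2 x y x0; rewrite -[RHS](sum_delta (fun=> 1) ((y
  + x ^+ 2) / (2%:R * x))).
apply: eq_bigr => u _; rewrite mul1r; congr (_ %:R)%R; congr nat_of_bool.
have x2 : 2%:R * x != 0 by rewrite mulf_neq0.
rewrite -[RHS](inj_eq (mulIf x2)) divfK // -[LHS]subr_eq0 -[RHS]subr_eq0;
  congr (_ == 0).
by ring.
Qed.

(** As signs, its values 0, 0, 0, 1 form the first row of the circulant Hadamard matrix of order
    4. *)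
Definition bit3 (x : 'Z_4) : 'Z_2 := if x == 3%:R then 1 else 0.

Lemma bit3_bent : bent bit3 2.
Proof.
move=> x y; rewrite !big_ord_recl big_ord0.
case: x => [[|[|[|[|//]]]] ?] //; case: y => [[|[|//]] ?] // _; by vm_compute.
Qed.

Section NonSchur.

Variables (gT : finGroupType) (SG : Schur_group gT).

Lemma Schur_no_square_plane (F : finFieldType) (phi : dih F F -> gT) :
  2%:R != 0 :> F -> injective phi -> ~ {morph phi : g h / (g * h)%g}.
Proof.
move=> F2 phi_inj phiM; pose h (x : F) := x ^+ 2.
have := Schur_subgroup_color_automorphism phi_inj phiM (@bent_color1 _ _ h)
  (@bent_colorV _ _ h) (bent_colorM (square_bent F2) (oner_neq0 F)).
case/(_ (0, 1, false) (0, 2%:R, false) SG).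
  by rewrite /bent_color /= (negPf F2) oner_eq0.
move=> f [f1 f12 fc]; have [G [k [fG GE]]] := bent_automorphism f1 fc.
have G0 : G 0 0 = 0.
  by have := fG 0 0; rewrite (f1 : f (0, 0, false) = _) => -[].
have Gid t : G 0 t = t.
  have [w ->] : exists w, t = 2%:R * w by exists (t / 2%:R);
    rewrite mulrC divfK.
  (* Comparing the two expressions for [G 1 (1 + 2w)] based at [0] and at [w] gives [G 0 (2w) = 2w].
     So [G 0] is the identity and cannot send 1 to 2. *)
  have := GE 1 0 (1 + 2%:R * w + 0); rewrite (GE 1 w) /h.
  rewrite !add0r addr0.
  have -> : w ^+ 2 - (w + 1) ^+ 2 + (1 + 2%:R * w) = 0 by ring.
  rewrite expr0n expr1n sub0r addKr.
  rewrite G0 => /eqP; rewrite eq_sym addr0 -subr_eq0 => /eqP E.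
  by apply/eqP; rewrite -subr_eq0 -[X in _ == X]E; apply/eqP; ring.
move: f12; rewrite fG Gid => -[/eqP]; rewrite -subr_eq0 -opprB oppr_eq0.
by rewrite -[2%:R]/(1 + 1) addrK oner_eq0.
Qed.

Lemma Schur_no_Z4xZ2 (phi : dih 'Z_4 'Z_2 -> gT) :
  injective phi -> ~ {morph phi : g h / (g * h)%g}.
Proof.
move=> phi_inj phiM.
have := Schur_subgroup_color_automorphism phi_inj phiM (@bent_color1 _ _ bit3)
  (@bent_colorV _ _ bit3) (bent_colorM bit3_bent (oner_neq0 'Z_2)).
case/(_ (2%:R, 0, false) (2%:R, 1, false) SG) => //.
move=> f [f1 f12 fc]; have [G [k [fG GE]]] := bent_automorphism f1 fc.
have G0 : G 0 0 = 0.
  by have := fG 0 0; rewrite (f1 : f (0, 0, false) = _) => -[].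
have G1 : G 0 1 = 1.
  have : G 0 1 != 0.
    have := fc 1%g (0, 1, false);
      rewrite f1 fG invg1 !mulg1 /bent_color /= => -[].
    by move=> ->.
  by case: (G 0 1) => [[|[|//]] ?] // _; apply: val_inj.
have G20 : G 2%:R 0 = 1 by move: f12; rewrite fG => -[].
have Gid t : G 0 t = t.
  have [->|->] : t = 0 \/ t = 1; rewrite ?G0 ?G1 //.
  by case: t => [[|[|//]] lt]; [left|right]; apply: val_inj.
(* As [G 0] is the identity, [G 2 0 = 1] forces [bit3 (2 + k) - bit3 k = 1], while the two
   expressions for [G 1 0] based at 0 and at 1 force [bit3 (2 + k) = bit3 k]. *)
have := GE 2%:R 0 0; rewrite G20 Gid; have := GE 1 0 0; rewrite (GE 1 1 0) !Gid.
by clear; case: k => [[|[|[|[|//]]]] lt] /(congr1 val) + /(congr1 val);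
  vm_compute.
Qed.

End NonSchur.

(** * The covering of a dihedral group of order 2m with Klein fibres *)

Lemma F2_addxx (s : 'F_2) : s + s = 0.
Proof. by case: s => [[|[|//]] ?]; apply: val_inj. Qed.

Section KleinCover.

Variable m : nat.
Local Notation X := 'Z_m.
Local Notation L := 'rV['F_2]_2.

Let vec (s t : 'F_2) : L := \row_j (if j == 0 then s else t).

Let vec0 s t : vec s t 0 0 = s. Proof. by rewrite mxE. Qed.
Let vec1 s t : vec s t 0 1 = t. Proof. by rewrite mxE. Qed.

(* Over the element (x, k) of the dihedral group of order 2m the fibre L is    *)
(* cut into cosets of the kernel of klein_form x k: this kernel is 0 over the *)
(* identity, one fixed line over the other rotations, the two other lines     *)
(* over the reflections x = 0 and x = 1, and L elsewhere.                      *)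
Definition klein_form (x : X) (k : bool) (l : L) : 'F_2 * 'F_2 :=
  if k then
    if x == 0 then (l 0 0, 0) else if x == 1 then (l 0 0 + l 0 1, 0) else (0, 0)
  else if x == 0 then (l 0 0, l 0 1) else (l 0 1, 0).

Local Arguments klein_form : simpl never.

Definition klein_color (g : dih X L) : X * bool * ('F_2 * 'F_2) :=
  (g.1.1, g.2, klein_form g.1.1 g.2 g.1.2).

Lemma klein_form_sub x k l d : klein_form x k d = (0, 0) ->
  klein_form x k (l + d) = klein_form x k l.
Proof.
rewrite /klein_form; case: k; [case: (x == 0);
  last case: (x == 1) => //|case: (x == 0)]; rewrite !mxE.
- by move=> -[->]; rewrite addr0.
- by move=> /(congr1 fst) /= E; rewrite addrACA E addr0.
- by move=> -[-> ->]; rewrite !addr0.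
- by move=> -[->]; rewrite addr0.
Qed.

Lemma klein_formB x k l l' : klein_form x k l = klein_form x k l' ->
  klein_form x k (l' - l) = (0, 0).
Proof.
rewrite /klein_form; case: k; [case: (x == 0);
  last case: (x == 1) => //|case: (x == 0)]; rewrite !mxE.
- by move=> -[->]; rewrite subrr.
- by move=> /(congr1 fst) /= E; rewrite addrACA -opprD E subrr.
- by move=> -[-> ->]; rewrite !subrr.
- by move=> -[->]; rewrite subrr.
Qed.

Lemma klein_formN x k l : klein_form x k l = (0,
  0) -> klein_form x k (- l) = (0, 0).
Proof.
rewrite /klein_form; case: k; [case: (x == 0);
  last case: (x == 1) => //|case: (x == 0)]; rewrite !mxE.
- by move=> -[->]; rewrite oppr0.
- by move=> /(congr1 fst) /= E; rewrite -opprD E oppr0.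
- by move=> -[-> ->]; rewrite !oppr0.
- by move=> -[->]; rewrite oppr0.
Qed.

Let F2N (s : 'F_2) : - s = s.
Proof. by apply/eqP; rewrite eq_sym -subr_eq0 opprK F2_addxx. Qed.

(* Two different lines of the Klein group span it. *)
Lemma klein_form_split x k x' k' d :
  klein_form (x + sgb k x') (k (+) k') d = (0, 0) ->
  exists d1 d2, [/\ d = d1 + d2, klein_form x k d1 = (0, 0)
    & klein_form x' k' d2 = (0, 0)].
Proof.
have form0 y h : klein_form y h 0 = (0, 0).
  by rewrite /klein_form !mxE addr0; case: h => //; case: (y == 0) => //;
    case: (y == 1).
have vecE s t : d = vec s t + vec (d 0 0 - s) (d 0 1 - t).
  apply/rowP=> j; rewrite !mxE; case: eqP => [->|/eqP nj];
    rewrite addrC subrK //.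
  by congr (d 0 _); apply: val_inj; case: j nj => [[|[|//]]].
set split_d := (exists d1, _).
have use s t : klein_form x k (vec s t) = (0, 0) ->
    klein_form x' k' (vec (d 0 0 - s) (d 0 1 - t)) = (0, 0) -> split_d.
  by move=> h1 h2; exists (vec s t), (vec (d 0 0 - s) (d 0 1 - t)).
have left : klein_form x k d = (0, 0) -> split_d by exists d, 0; rewrite addr0.
have right : klein_form x' k' d = (0, 0) -> split_d by exists 0, d;
  rewrite add0r.
have zero y h : klein_form y h d = (0, 0) -> y = 0 -> h = false -> split_d.
  move=> + y0 h0; rewrite y0 h0 /klein_form eqxx => -[d0 d1]; apply: left.
  suff -> : d = 0 by apply: form0.
  by rewrite (vecE 0 0) d0 d1 subrr; apply/rowP=> j; rewrite !mxE;
    case: (j == 0); rewrite addr0.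
move: use left right zero; move: split_d => S use left right zero.
(* In each case the product is the identity, so that [d = 0], or one factor's kernel contains the
   product's, or the factors have distinct lines as kernels and [use] gives the components. *)
case: k k' use left right => -[] use left right; rewrite /= => fd.
- case: (eqVneq x 0) => [x0|nx0].
    case: (eqVneq x' 0) => [x'0|nx'0]; first by apply: (zero _ _ fd);
      rewrite ?x0 ?x'0 ?subrr.
    case: (eqVneq x' 1) => [x'1|nx'1].
      apply: (use 0 (d 0 1 - d 0 0));
        rewrite /klein_form ?x0 ?x'1 ?eqxx ?oner_eq0 !vec0 ?vec1 //.
      by rewrite subr0 subKr F2_addxx.
    by apply: right; rewrite /klein_form (negPf nx'0) (negPf nx'1).
  case: (eqVneq x 1) => [x1|nx1]; last first.
    by apply: left; rewrite /klein_form (negPf nx0) (negPf nx1).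
  case: (eqVneq x' 0) => [x'0|nx'0].
    apply: (use (d 0 0) (d 0 0));
      rewrite /klein_form ?x1 ?x'0 ?eqxx ?oner_eq0 !vec0 ?vec1 ?F2_addxx //.
    by rewrite subrr.
  case: (eqVneq x' 1) => [x'1|nx'1]; first by apply: (zero _ _ fd);
    rewrite ?x1 ?x'1 ?subrr.
  by apply: right; rewrite /klein_form (negPf nx'0) (negPf nx'1).
- case: (eqVneq x' 0) => [x'0|nx'0]; first by apply: left;
  rewrite x'0 oppr0 addr0 in fd.
  case: (eqVneq x 0) => [x0|nx0].
    by apply: (use 0 (d 0 1));
      rewrite /klein_form ?x0 ?(negPf nx'0) ?eqxx ?vec0 ?vec1 ?subrr.
  case: (eqVneq x 1) => [x1|nx1]; last first.
    by apply: left; rewrite /klein_form (negPf nx0) (negPf nx1).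
  by apply: (use (d 0 1) (d 0 1));
    rewrite /klein_form ?x1 ?(negPf nx'0) ?eqxx ?oner_eq0 ?vec0 ?vec1 ?subrr
    ?F2_addxx.
- case: (eqVneq x 0) => [x0|nx0]; first by apply: right; rewrite x0 add0r in fd.
  case: (eqVneq x' 0) => [x'0|nx'0].
    by apply: (use (d 0 0) 0);
      rewrite /klein_form ?x'0 ?(negPf nx0) ?eqxx ?vec0 ?vec1 ?subrr.
  case: (eqVneq x' 1) => [x'1|nx'1]; last first.
    by apply: right; rewrite /klein_form (negPf nx'0) (negPf nx'1).
  apply: (use (d 0 0 - d 0 1) 0);
    rewrite /klein_form ?x'1 ?(negPf nx0) ?eqxx ?oner_eq0 ?vec0 ?vec1 //.
  by rewrite subKr subr0 F2_addxx.
- case: (eqVneq x 0) => [x0|nx0]; first by apply: right; rewrite x0 add0r in fd.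
  case: (eqVneq (x + x') 0) => [xx'|nxx']; first exact: (zero _ _ fd).
  by apply: left; move: fd; rewrite /klein_form (negPf nx0) (negPf nxx').
Qed.

Lemma klein_color1 g : klein_color g = klein_color 1%g -> g = 1%g.
Proof.
case: g => [[x l] k]; rewrite /klein_color /= => -[-> ->];
  rewrite /klein_form eqxx !mxE => -[l0 l1].
congr (_, _, _); apply/rowP=> j; rewrite !mxE; case: j => [[|[|//]] lj].
  by rewrite -[RHS]l0; congr (l _ _); apply: val_inj.
by rewrite -[RHS]l1; congr (l _ _); apply: val_inj.
Qed.

Lemma klein_colorV g g' :
  klein_color g = klein_color g' -> klein_color g^-1%g = klein_color g'^-1%g.
Proof.
case: g g' => [[x l] k] [[x' l'] k'];
  rewrite /klein_color !dih_invE /= => -[-> ->].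
case: k' => /= [-> //|]; rewrite /klein_form oppr_eq0; case: (x' == 0);
  rewrite !mxE.
  by move=> -[-> ->].
by move=> -[->].
Qed.

(** Two like-coloured elements differ by some [d] in the kernel over their common base point.
    Splitting [d] between the kernels over the two factors and reindexing each fibre sum by the
    first component changes neither factor's colour. *)
Lemma klein_colorM (a b : group_ring (dih X L)) :
  color_constant klein_color a -> color_constant klein_color b ->
  color_constant klein_color (a * b).
Proof.
move=> ca cb [[x l] k] [[x' l'] k'] [<- <-] /klein_formB Fd.
rewrite !ffunE !dih_sum; congr (_ + _); apply: eq_bigr => x1 _.
  have [|d1 [d2 [dE F1 F2]]] := @klein_form_split x1 false (- x1
    + x) k (l' - l).
    by rewrite /= addrA subrr add0r.
  rewrite [RHS](reindex_inj (addIr d1)); apply: eq_bigr => n _; congr (_ * _).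
    by apply: ca; rewrite /klein_color /= klein_form_sub.
  apply: cb; rewrite /klein_color !dih_mulE !dih_invE /=.
  have -> : - (n + d1) + l' = - n + l + d2;
    last by rewrite [in RHS]klein_form_sub.
  rewrite -(subrK l l') dE opprD -!addrA; congr (- n + _).
  by rewrite addKr addrC.
have [|d1 [d2 [dE F1 F2]]] := @klein_form_split x1 true (x1 - x) (~~ k) (l' -
  l).
  by rewrite /= opprB addrC subrK negbK.
rewrite [RHS](reindex_inj (addIr d1)); apply: eq_bigr => n _; congr (_ * _).
  by apply: ca; rewrite /klein_color /= klein_form_sub.
apply: cb; rewrite /klein_color !dih_mulE !dih_invE /=.
have -> : n + d1 - l' = n - l - d2;
  last by rewrite [in RHS]klein_form_sub ?klein_formN.
rewrite -(subrK l l') dE -!addrA; congr (n + _).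
by rewrite !opprD addrA subrr add0r addrC.
Qed.

(** A permutation sending [(1, 0)] to [(1, vec 1 0)] is followed on the zero section, along the
    cycle through the reflection classes over 0 and 1: each step adds the same [c] to the first
    fibre coordinate, and returning after an odd number [m] of steps forces [c = 0], so the shift at
    1 vanishes. *)
Lemma Schur_no_klein_cover (gT : finGroupType) (phi : dih X L -> gT) :
  odd m -> (1 < m)%N -> Schur_group gT ->
  injective phi -> ~ {morph phi : g h / (g * h)%g}.
Proof.
move=> m_odd m_gt1 SG phi_inj phiM.
have X10 : (1 : X) != 0 by apply: oner_neq0.
have rot x l : x != 0 -> klein_form x false l = (l 0 1, 0).
  by rewrite /klein_form => /negPf->.
have := Schur_subgroup_color_automorphism phi_inj phiM klein_color1
  klein_colorV klein_colorM.
case/(_ (1, 0, false) (1, vec 1 0, false) SG).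
  by rewrite /klein_color /= !rot // vec1 mxE.
move=> f [f1 fx fc].
have fE x k : exists l : L, f (x, 0, k) = (x, l, k).
  have := fc 1%g (x, 0, k); rewrite f1 invg1 !mulg1 /klein_color.
  by case: (f _) => [[x' l] k'] /= -[-> ->]; exists l.
pose F x k := (f (x, 0, k)).1.2.
have fF x k : f (x, 0, k) = (x, F x k, k) by rewrite /F; have [l ->] := fE x k.
have F0 : F 0 false = 0 by have := fF 0 false;
  rewrite (f1 : f (0, 0, false) = _) => -[].
have F11 : F 1 false = vec 1 0 by move: fx; rewrite fF => -[].
have rel x k x' k' : klein_form (x' - sgb (k' (+) k) x) (k' (+) k)
    (F x' k' - sgb (k' (+) k) (F x k))
      = klein_form (x' - sgb (k' (+) k) x) (k' (+) k) 0.
  have := fc (x, 0, k) (x', 0, k');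
    rewrite !fF /klein_color !dih_mulE !dih_invE /=.
  by move=> /(congr1 snd) /=; case: k k' => -[] /=;
    rewrite ?oppr0 ?opprK ?addr0.
have form0 x k : klein_form x k 0 = (0, 0).
  by rewrite /klein_form !mxE addr0; case: k => //; case: (x == 0) => //;
    case: (x == 1).
have F_rot x : F x false 0 1 = 0.
  case: (eqVneq x 0) => [->|x0]; first by rewrite F0 mxE.
  by have /(congr1 fst) := rel 0 false x false; rewrite /= form0 F0 !subr0 rot.
pose c := F 0 true 0 1.
have F_refl x : F x true 0 1 = c.
  case: (eqVneq x 0) => [->//|x0].
  have /(congr1 fst) := rel 0 true x true; rewrite /= form0 subr0 rot //= !mxE.
  by move/eqP; rewrite subr_eq0 => /eqP.
have F_inv x : F x false 0 0 = F (- x) true 0 0.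
  have /(congr1 fst) := rel x false (- x) true;
    rewrite /= form0 opprK addNr /klein_form eqxx /= opprK !mxE.
  by move/eqP; rewrite addr_eq0 F2N => /eqP.
(* The rotations [x] and [x + 1] are both joined to the reflection [- x], by quotients over the
   reflections 0 and 1 respectively; the second line also brings in the coordinate [c]. *)
have F_step x : F (x + 1) false 0 0 = F x false 0 0 + c.
  have /(congr1 fst) := rel (x + 1) false (- x) true.
  rewrite /= form0 opprK addKr /klein_form eqxx (negPf X10) /= opprK !mxE
    F_refl F_rot addr0.
  rewrite -F_inv => /eqP; rewrite addrAC addr_eq0 F2N => /eqP <-.
  by [].
have F_nat n : F n%:R false 0 0 = c *+ n.
  elim: n => [|n IHn]; first by rewrite F0 mxE.
  by rewrite -natr1 F_step IHn mulrSr.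
have c0 : c = 0.
  have := F_nat m; rewrite pchar_Zp // F0 mxE -[in RHS](odd_double_half m)
    m_odd.
  by rewrite -addnn !mulrnDr F2_addxx addr0.
have := F_nat 1; rewrite F11 vec0 c0 mul0rn => /eqP.
by rewrite oner_eq0.
Qed.

End KleinCover.

(** * Embedding the forbidden subgroups; cyclicity of A *)

Section ExpgZp.

Variables (gT : finGroupType) (x : gT) (n : nat).
Hypotheses (n_gt1 : (1 < n)%N) (ox : #[x]%g = n).

Lemma expg_ZpD : {morph (fun k : 'Z_n => x ^+ k)%g : k l / k + l >-> (k * l)%g}.
Proof.
move=> k l; rewrite /= -expgD -[RHS]expg_mod_order ox.
by congr (x ^+ (_ %% _))%g; apply: Zp_cast.
Qed.

Lemma expg_Zp_inj : injective (fun k : 'Z_n => x ^+ k)%g.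
Proof.
move=> k l /eqP; rewrite eq_expg_mod_order ox => /eqP kl; apply: val_inj.
have lt_n (i : 'Z_n) : (i < n)%N by rewrite -[X in (_ < X)%N](Zp_cast n_gt1).
by move: kl; rewrite !modn_small.
Qed.

End ExpgZp.

Lemma cycle_disjoint (gT : finGroupType) (s t x : gT) :
  prime #[t]%g -> t \notin <[s]>%g -> x \in <[s]>%g -> x \in <[t]>%g -> x = 1%g.
Proof.
move=> pt nt xs xt; apply/set1gP; have <- : <[t]>%g :&: <[s]>%g = 1%g.
  by apply: prime_TIg; rewrite // cycle_subG.
by rewrite inE xs xt.
Qed.

Section Noncyclic.

Variables (gT : finGroupType) (A : {group gT}) (b : gT).
Hypotheses (SG : Schur_group gT) (cA : abelian A) (nbA : b \notin A).
Hypotheses (bb : (b * b = 1)%g) (Ab : forall a, a \in A -> (a ^ b = a^-1)%g).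

Lemma Schur_odd_prime_cyclic (p : nat) (s t : gT) : prime p -> odd p ->
  s \in A -> t \in A -> #[s]%g = p -> #[t]%g = p -> t \in <[s]>%g.
Proof.
(* ['F_p] is the ring of integers modulo [pdiv p], so the orders are put in that form. *)
move=> p_pr p_odd sA tA; rewrite -{1 2}(pdiv_id p_pr) => os ot.
have q_pr : prime (pdiv p) by rewrite pdiv_id.
have q_gt1 := prime_gt1 q_pr.
apply: contraT => nts.
have [] := @dih_embedding gT 'F_p 'F_p (fun k => s ^+ k)%g (fun k =>
  t ^+ k)%g A b
  (expg_ZpD q_gt1 os) (expg_ZpD q_gt1 ot) (expg_Zp_inj q_gt1 os) (expg_Zp_inj
    q_gt1 ot)
  (fun k => groupX _ sA) (fun k => groupX _ tA) _ cA nbA bb Ab.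
  move=> k l E; apply: (expg_Zp_inj q_gt1 os) => /=.
  by rewrite expg0; apply: cycle_disjoint nts _ _;
    rewrite ?ot ?mem_cycle //= E mem_cycle.
have F2 : 2%:R != 0 :> 'F_p.
  rewrite -(dvdn_pcharf (pchar_Fp p_pr)) gtnNdvd //.
  by case: p p_pr p_odd {os ot q_pr q_gt1} => [|[|[]]].
by move=> phi_inj phiM; case: (Schur_no_square_plane SG F2 phi_inj phiM).
Qed.

Lemma Schur_order4_involution (x t : gT) :
  x \in A -> t \in A -> #[x]%g = 4%N -> #[t]%g = 2%N -> t \in <[x]>%g.
Proof.
move=> xA tA ox ot; apply: contraT => ntx.
have [] := @dih_embedding gT ('Z_4) ('Z_2) (fun k => x ^+ k)%g (fun k =>
  t ^+ k)%g A b
  (expg_ZpD (n := 4) isT ox) (expg_ZpD (n := 2) isT ot) (expg_Zp_inj (n := 4)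
    isT ox) (expg_Zp_inj (n := 2) isT ot)
  (fun k => groupX _ xA) (fun k => groupX _ tA) _ cA nbA bb Ab.
  move=> k l E; apply: (expg_Zp_inj (isT : (1 < 4)%N) ox) => /=.
  by rewrite expg0; apply: cycle_disjoint ntx _ _;
    rewrite ?ot ?mem_cycle //= E mem_cycle.
by move=> phi_inj phiM; case: (Schur_no_Z4xZ2 SG phi_inj phiM).
Qed.

Lemma Schur_odd_klein (m : nat) (c s t : gT) : odd m -> (1 < m)%N ->
  c \in A -> s \in A -> t \in A -> #[c]%g = m -> #[s]%g = 2%N -> #[t]%g
    = 2%N -> t \in <[s]>%g.
Proof.
move=> m_odd m_gt1 cinA sA tA oc os ot; apply: contraT => nts.
have comm x y : x \in A -> y \in A -> (x * y = y * x)%g.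
  by move=> xA yA; apply: (centsP cA).
pose j (l : 'rV['F_2]_2) := (s ^+ l 0%R 0%R * t ^+ l 0%R 1%R)%g.
have jD : {morph j : l l' / l + l' >-> (l * l')%g}.
  move=> l l'; rewrite /j !mxE; have /= -> := expg_ZpD (isT : (1 < 2)%N) os.
  have /= -> := expg_ZpD (isT : (1 < 2)%N) ot.
  rewrite -!mulgA; congr (_ * _)%g; rewrite !mulgA; congr (_ * _)%g.
  by apply: comm; rewrite groupX.
have j_inj : injective j.
  move=> l l' E.
  have E1 : ((s ^+ l' 0%R 0%R)^-1 * s ^+ l 0%R 0%R
    = t ^+ l' 0%R 1%R * (t ^+ l 0%R 1%R)^-1)%g.
    by apply: (mulgI (s ^+ l' 0%R 0%R)%g); apply: (mulIg (t ^+ l 0%R 1%R)%g);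
      rewrite mulKVg !mulgA mulgKV.
  have E2 : ((s ^+ l' 0%R 0%R)^-1 * s ^+ l 0%R 0%R = 1)%g.
    apply: cycle_disjoint nts _ _; rewrite ?ot //; last rewrite E1;
      by rewrite groupM ?groupV ?mem_cycle.
  have l00 : l 0 0 = l' 0 0.
    by apply: (expg_Zp_inj (n := 2) isT os);
      apply: (mulgI (s ^+ l' 0%R 0%R)^-1)%g; rewrite /= E2 mulVg.
  have l01 : l 0 1 = l' 0 1.
    apply: (expg_Zp_inj (n := 2) isT ot); apply/esym;
      apply: (mulIg (t ^+ l 0%R 1%R)^-1)%g.
    by rewrite /= -E1 E2 mulgV.
  apply/rowP=> i; case: (eqVneq i 0) => [->//|ni0].
  have -> // : i = 1 by apply: val_inj; case: i ni0 => [[|[|//]]].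
have [] := @dih_embedding gT ('Z_m) ('rV['F_2]_2) (fun k => c ^+ k)%g j A b
  (expg_ZpD m_gt1 oc) jD (expg_Zp_inj m_gt1 oc) j_inj
  (fun k => groupX _ cinA) (fun l =>
    groupM (groupX _ sA) (groupX _ tA)) _ cA nbA bb Ab.
  move=> k l E; apply: (expg_Zp_inj m_gt1 oc) => /=; rewrite expg0.
  (* An element common to the two images has order dividing 2 and also the odd number [m], hence is
     trivial. *)
  have ll : l + l = 0 by apply/rowP=> i; rewrite !mxE F2_addxx.
  have j0 : j 0 = 1%g by rewrite /j !mxE !expg0 mulg1.
  have : (#[c]%g %| k * 2)%N.
    by rewrite order_dvdn expgM E expgS expg1 -jD ll j0.
  rewrite Gauss_dvdl; last by rewrite coprimen2 oc.
  by rewrite order_dvdn => /eqP.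
by move=> phi_inj phiM;
  case: (Schur_no_klein_cover m_odd m_gt1 SG phi_inj phiM).
Qed.

(** Otherwise A contains E = C_p x C_p. An odd [p] is excluded at once. For [p = 2], either [a] has
    a nontrivial part of odd order, which goes with E, or [a] is a 2-element with a power of order
    4, which goes with an involution of E. *)
Lemma Schur_cyclic : (exists2 a, a \in A & (a ^+ 2 != 1)%g) -> cyclic A.
Proof.
case=> a aA a2; rewrite abelian_rank1_cyclic // leqNgt; apply/negP.
have [p p_pr ->] := rank_witness A; case/p_rank_geP=> E /pnElemP[EA abE logE].
have oE : #|E| = (p ^ 2)%N by rewrite (card_pgroup (abelem_pgroup abE)) logE.
have p_gt1 := prime_gt1 p_pr.
have [s sE s1] : exists2 s, s \in E & s != 1%g.
  by apply/trivgPn; rewrite trivg_card1 oE -(exp1n 2) eqn_exp2r // neq_ltn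
    p_gt1 orbT.
have os : #[s]%g = p by apply: abelem_order_p abE sE s1.
have small (x : gT) : (#[x]%g < p ^ 2)%N -> exists2 t,
  t \in E & t \notin <[x]>%g.
  move=> ox; apply/subsetPn; apply: contraL ox => /subset_leq_card.
  by rewrite oE -leqNgt.
have nontriv (x t : gT) : t \in E -> t \notin <[x]>%g -> #[t]%g = p.
  by move=> tE nt; apply: abelem_order_p abE tE _; apply: contraNneq nt => ->;
    apply: group1.
have [t tE nts] : exists2 t, t \in E & t \notin <[s]>%g.
  by apply: small; rewrite os -[X in (X < _)%N]expn1 ltn_exp2l.
have ot := nontriv _ _ tE nts.
have inA := subsetP EA.
case: (boolP (odd p)) => [p_odd|].
  by case/negP: nts; apply: (Schur_odd_prime_cyclic p_pr p_odd); rewrite ?inA.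
case: (even_prime p_pr) => [p2 _|->//];
  rewrite {}p2 in os ot oE small nontriv abE *.
have o2' : #[(a.`_2%N^')%g]%g = (#[a]%g`_2%N^')%N by apply: order_constt.
case: (ltnP 1 #[(a.`_2%N^')%g]%g) => [m_gt1|m_le1].
  case/negP: nts; apply: (Schur_odd_klein (c := (a.`_2%N^')%g) _ m_gt1);
    rewrite ?(inA s) ?(inA t) //.
    by rewrite o2' odd_2'nat part_pnat.
  by apply: subsetP (cycle_constt _ _); rewrite cycle_subG.
have oa : #[a]%g = (2 ^ logn 2 #[a]%g)%N.
  rewrite -p_part -{1}(partnC 2%N (order_gt0 a)).
  have -> : (#[a]%g`_2%N^')%N = 1%N by apply/eqP;
    rewrite eqn_leq -o2' m_le1 order_gt0.
  by rewrite muln1.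
have dvd4 : (4 %| #[a]%g)%N.
  rewrite oa (_ : 4 = 2 ^ 2)%N // dvdn_exp2l // leqNgt; apply: contra a2 => lt2.
  by rewrite -order_dvdn oa -[X in (_ %| X)%N]expn1 dvdn_exp2l.
pose x := (a ^+ (#[a] %/ 4))%g.
have ox : #[x]%g = 4%N.
  rewrite /x orderXdiv ?dvdn_div // -{1}(divnK dvd4) mulKn // divn_gt0 //.
  by rewrite dvdn_leq.
(* E and [<[x]>] both have order 4, so an inclusion would put [x], of order 4, in a group of
   exponent 2. *)
have [u uE nux] : exists2 u, u \in E & u \notin <[x]>%g.
  apply/subsetPn; apply/negP=> sEx.
  have /setP/(_ x) : E = <[x]>%g :> {set gT}.
    by apply/eqP; rewrite eqEcard sEx oE -orderE ox.
  rewrite cycle_id => xE.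
  have x1 : x != 1%g by rewrite -order_gt1 ox.
  by have := abelem_order_p abE xE x1; rewrite ox.
have ou := nontriv _ _ uE nux.
case/negP: nux; apply: Schur_order4_involution ox ou; last exact: inA.
by rewrite groupX.
Qed.

End Noncyclic.

(** * Recognition of the dihedral group *)

Lemma inverted_cyclic_dihedral (gT : finGroupType) (a b : gT) :
  (1 < #[a]%g)%N -> <[a]>%g ><| <[b]>%g = [set: gT] -> #[b]%g
    = 2%N -> (a ^ b = a^-1)%g ->
  ([set: gT] \isog 'D_(2 * #[a]))%g.
Proof.
move=> a_gt1 defG ob ab; rewrite mul2n.
apply/(isoGrpP _ (Grp_dihedral a_gt1)); split.
  by rewrite card_dihedral // -(sdprod_card defG) -!orderE ob muln2.
apply/existsP; exists (a, b); rewrite /= !xpair_eqE.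
by rewrite !expg_order -ob expg_order ab !eqxx; have /sdprodWY -> := defG;
  rewrite eqxx.
Qed.

Theorem theorem1p1 (gT : finGroupType) :
  generalized_dihedral gT -> Schur_group gT ->
  exists2 n : nat, (3 <= n)%N & ([set: gT] \isog 'D_(2 * n))%g.
Proof.
move=> [nabG [A [b [defG cA ob Ab]]]] SG.
have [_ _ AbG _ Ab1] := sdprod_context (G := [set: gT]%G) defG.
have bb : (b * b = 1)%g by have := expg_order b; rewrite ob expgS expg1.
have nbA : b \notin A.
  apply/negP=> bA; have /set1gP b1 : b \in [1 gT]%g
    by rewrite -Ab1 inE bA cycle_id.
  by rewrite b1 order1 in ob.
(* If every element of A squared to 1, inversion would be trivial, [b] would centralize A and G
   would be abelian. *)
have a2 : exists2 a, a \in A & (a ^+ 2 != 1)%g.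
  apply/exists_inP; apply: contraR nabG => /exists_inPn A2.
  rewrite -AbG abelianM cA cycle_abelian cycle_subG.
  apply/centP=> a aA; apply/commute_sym/commgP; rewrite commgEl Ab //.
  by rewrite -invMg -expg2 invg_eq1 -[_ == _]negbK A2.
have /cyclicP[a defA] := Schur_cyclic SG cA nbA bb Ab a2.
have aA : a \in A by rewrite defA cycle_id.
have [x xA x2] := a2.
have a3 : (3 <= #[a]%g)%N.
  rewrite ltnNge; apply: contra x2 => a_le2; rewrite -order_dvdn.
  have /order_dvdG xa : x \in <[a]>%g by rewrite -defA.
  rewrite -orderE in xa.
  by case: #[a]%g (order_gt0 a) a_le2 xa => [|[|[|]]] // _ _;
    rewrite dvdn1 => /eqP->.
exists #[a]%g => //; apply: inverted_cyclic_dihedral ob (Ab a aA).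
  exact: ltnW.
by rewrite -defA.
Qed.
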